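(* Suppose $A$ is an infinite set, $(A,\cdot)$ is a partial combinatory algebra and $\mathcal{K}_2(A)$ is based on $(A,\cdot)$. Let $\gamma:A\to\mathcal{K}_2(A)$ be the applicative morphism $\gamma(a)=\{\hat{a}\}$, where $\hat{a}$ is the constant function with value $a$. Then for any partial combinatory algebra $B$ and any decidable applicative morphism $\delta:A\to B$ such that every total function $A\to A$ is representable w.r.t. $\delta$, there is a greatest (with respect to the preorder $\preceq$) decidable applicative morphism $\varepsilon:\mathcal{K}_2(A)\to B$ such that $\varepsilon\gamma\cong\delta$.
   Context: Partial combinatory algebra (pca): a set $X$ with a partial function $X\times X\rightharpoonup X$, written $x,y\mapsto xy$, such that there exist $k,s\in X$ satisfying: $(k)$ for any $x,y$, $kx$ and $(kx)y$ are defined, and $(kx)y=x$; $(s)$ for any $x,y,z$, $sx$ and $(sx)y$ are defined, and $((sx)y)z$ is defined precisely if $(xz)(yz)$ is, and these denote the same element if defined. Iterated application associates to the left. Every pca contains: Booleans $\top,\bot$ and an element $C$ with $C\top ab=a$, $C\bot ab=b$; pairing and unpairing elements $p,p_0,p_1$ with $pab$ defined, $p_0(pab)=a$, $p_1(pab)=b$; a copy $\{\bar 0,\bar 1,\ldots\}$ of the natural numbers for which every computable function is represented by an element; and a standard coding of finite tuples $(u_0,\ldots,u_{n-1})\mapsto[u_0,\ldots,u_{n-1}]$ (injective when the pca has more than one element) together with elements representing its basic manipulations (length, components, concatenation, forming $[y]$, appending an element). $\mathcal{K}_2(A)$ based on $(A,\cdot)$ is the pca with underlying set $A^A$ (all functions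 $A\to A$) and the following application, in which sequences are coded by the standard coding $[\cdot,\ldots,\cdot]$ of $(A,\cdot)$, the query and result markers are $\bot$ and $\top$, and query and result values are $p\bot b$ and $p\top c$. For $\alpha,\beta\in A^A$ and $a\in A$, $[a_0,\ldots,a_{n-1}]$ is an $a$-interrogation of $\beta$ by $\alpha$ if for each $j\le n-1$ there is $b\in A$ with $\alpha([a,a_0,\ldots,a_{j-1}])=p\bot b$ and $\beta(b)=a_j$. $\varphi^a(\alpha,\beta)$ is defined with value $c$ if for some $a$-interrogation $[a_0,\ldots,a_{n-1}]$ of $\beta$ by $\alpha$, $\alpha([a,a_0,\ldots,a_{n-1}])=p\top c$. $\alpha\beta$ is defined iff $\varphi^a(\alpha,\beta)$ is defined for every $a\in A$, and then $\alpha\beta$ is $a\mapsto\varphi^a(\alpha,\beta)$. An applicative morphism $\gamma:X\to Y$ between pcas assigns to each $x\in X$ a nonempty subset $\gamma(x)\subseteq Y$ such that there is $t\in Y$ (a realizer) with: whenever $x,x'\in X$, $y\in\gamma(x)$, $y'\in\gamma(x')$ and $xx'$ is defined, then $tyy'$ is defined and in $\gamma(xx')$. Composition is composition of relations: $(\varepsilon\gamma)(x)=\bigcup_{y\in\gamma(x)}\varepsilon(y)$. For $\gamma,\gamma':X\to Y$, $\gamma\preceq\gamma'$ means there is $t\in Y$ such that for all $x\in X$ and $y\in\gamma(x)$, $ty$ is defined and in $\gamma'(x)$; $\gamma\cong\gamma'$ means $\gamma\preceq\gamma'$ and $\gamma'\preceq\gamma$. With Booleans $\top_X,\bot_X$ in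 $X$ and $\top_Y,\bot_Y$ in $Y$, $\gamma$ is decidable if there is $d\in Y$ with $dy=\top_Y$ for all $y\in\gamma(\top_X)$ and $dy=\bot_Y$ for all $y\in\gamma(\bot_X)$. A partial function $f:X\rightharpoonup X$ is representable w.r.t. $\gamma$ if there is $r_f\in Y$ such that for all $x\in{\rm dom}(f)$ and $y\in\gamma(x)$, $r_fy$ is defined and in $\gamma(f(x))$. *)

(* Defs.v *)
From Stdlib Require Export List FinFun.
From Stdlib Require Import Arith Lia ClassicalEpsilon FunctionalExtensionality.
Import ListNotations.
Set Implicit Arguments.
Unset Strict Implicit.

(** Partial functions are [option]-valued, so that [=] between the values of
    two compound applications is Kleene equality. *)
Definition lift_app (X : Type) (f : X -> X -> option X) (u v : option X) :
  option X :=
  match u, v with Some x, Some y => f x y | _, _ => None end.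

Record pca : Type := Pca {
  car :> Type;
  papp : car -> car -> option car;
  pca_k : exists k : car, forall x y : car,
    lift_app papp (papp k x) (Some y) = Some x;
  pca_s : exists s : car,
    (forall x y : car, lift_app papp (papp s x) (Some y) <> None) /\
    (forall x y z : car,
       lift_app papp (lift_app papp (papp s x) (Some y)) (Some z) =
       lift_app papp (papp x z) (papp y z)) }.

Definition val (X : pca) (x : X) : option X := Some x.
Coercion val : car >-> option.

Definition oapp (X : pca) : option X -> option X -> option X :=
  lift_app (papp (p:=X)).
Infix "•" := oapp (at level 40, left associativity).

Definition apps (X : pca) (x : X) (l : list X) : option X :=
  fold_left (fun u (y : X) => u • y) l (x : option X).

Record booleans (X : pca) : Type := Booleans {
  tru : X;
  fls : X;
  cond : X;
  cond_tru : forall a b : X, cond • tru • a • b = a;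
  cond_fls : forall a b : X, cond • fls • a • b = b }.

(** Kleene's partial recursive functions.  Programs carry no arity: an
    application to a list of the wrong length need not compute anything. *)
Inductive prog : Type :=
| Zero
| Succ
| Proj (i : nat)
| Comp (f : prog) (gs : list prog)
| Prec (f g : prog)
| Mu (f : prog).

Inductive computes : prog -> list nat -> nat -> Prop :=
| computes_zero v : computes Zero v 0
| computes_succ n v : computes Succ (n :: v) (S n)
| computes_proj i v m : nth_error v i = Some m -> computes (Proj i) v m
| computes_comp f gs v w m :
    Forall2 (fun g y => computes g v y) gs w -> computes f w m ->
    computes (Comp f gs) v m
| computes_prec0 f g v m : computes f v m -> computes (Prec f g) (0 :: v) m
| computes_precS f g n v r m :
    computes (Prec f g) (n :: v) r -> computes g (n :: r :: v) m ->
    computes (Prec f g) (S n :: v) m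
| computes_mu f v m :
    computes f (m :: v) 0 ->
    (forall i, i < m -> exists j, computes f (i :: v) (S j)) ->
    computes (Mu f) v m.

(** [pair a b] is the value of [pr a b]; [tup u] is the element of the pca that
    codes the tuple [u].  Any choice of these data is allowed, and
    [coding_exists] below shows that every pca has one. *)
Record coding (X : pca) : Type := Coding {
  bools :> booleans X;
  pr : X;
  pr0 : X;
  pr1 : X;
  pair : X -> X -> X;
  pr_pair : forall a b : X, pr • a • b = pair a b;
  pr0_pair : forall a b : X, pr0 • pair a b = a;
  pr1_pair : forall a b : X, pr1 • pair a b = b;
  num : nat -> X;
  num_inj : (exists a b : X, a <> b) -> Injective num;
  num_computable : forall (e : prog) (n : nat), exists r : X,
    forall (v : list nat) (m : nat),
      length v = n -> computes e v m -> apps r (map num v) = num m;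
  tup : list X -> X;
  tup_inj : (exists a b : X, a <> b) -> Injective tup;
  tup_length : X;
  tup_lengthE : forall u, tup_length • tup u = num (length u);
  tup_comp : X;
  tup_compE : forall u i (x : X),
    nth_error u i = Some x -> tup_comp • tup u • num i = x;
  tup_cat : X;
  tup_catE : forall u v, tup_cat • tup u • tup v = tup (u ++ v);
  tup_sing : X;
  tup_singE : forall y : X, tup_sing • y = tup [y];
  tup_snoc : X;
  tup_snocE : forall u (y : X), tup_snoc • tup u • y = tup (u ++ [y]) }.

Definition interrogation (A : pca) (c : coding A) (a : A) (alpha beta : A -> A)
    (l : list A) : Prop :=
  forall j, j < length l -> exists b : A,
    alpha (tup c (a :: firstn j l)) = pair c (fls c) b /\
    nth_error l j = Some (beta b).

Definition phi (A : pca) (c : coding A) (alpha beta : A -> A) (a r : A) : Prop :=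
  exists l : list A, interrogation c a alpha beta l /\
    alpha (tup c (a :: l)) = pair c (tru c) r.

(** The value [r] is unique: see [phi_det] and [K2_appP]. *)
Definition K2_app (A : pca) (c : coding A) (alpha beta : A -> A) :
  option (A -> A) :=
  match excluded_middle_informative
          (forall a, exists r, phi c alpha beta a r) with
  | left H => Some (fun a => proj1_sig
                 (constructive_indefinite_description _ (H a)))
  | right _ => None
  end.

Lemma pca_point (X : pca) : exists x : X, True.
Proof. destruct (pca_k X) as [k _]; now exists k. Qed.

Lemma tru_neq_fls (X : pca) (b : booleans X) :
  (exists x y : X, x <> y) -> tru b <> fls b.
Proof.
intros [x [y nxy]] E; apply nxy.
generalize (cond_tru b x y) (cond_fls b x y); rewrite E; intros -> H.
now inversion H.
Qed.

Lemma pair_inj (X : pca) (c : coding X) (a b a' b' : X) :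
  pair c a b = pair c a' b' -> a = a' /\ b = b'.
Proof.
intros E.
generalize (pr0_pair c a b) (pr1_pair c a b); rewrite E.
rewrite pr0_pair, pr1_pair; intros H H'.
inversion H; inversion H'; auto.
Qed.

Inductive run (A : pca) (c : coding A) (alpha beta : A -> A) :
  list A -> A -> Prop :=
| run_result l r : alpha (tup c l) = pair c (tru c) r -> run c alpha beta l r
| run_query l b r :
    alpha (tup c l) = pair c (fls c) b ->
    run c alpha beta (l ++ [beta b]) r -> run c alpha beta l r.

Lemma firstn_snoc (B : Type) (l : list B) j x :
  nth_error l j = Some x -> firstn (S j) l = firstn j l ++ [x].
Proof.
revert j; induction l as [|y l IH]; intros [|j] E; try discriminate.
- now inversion E.
- exact (f_equal (cons y) (IH j E)).
Qed.

Lemma phi_run (A : pca) (c : coding A) (alpha beta : A -> A) (a r : A) :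
  phi c alpha beta a r <-> run c alpha beta [a] r.
Proof.
split.
- intros [l [Hl Hr]].
  assert (Hd : forall n, n <= length l ->
     run c alpha beta (a :: firstn (length l - n) l) r).
  { induction n as [|n IH]; intros Hn.
    - rewrite Nat.sub_0_r, firstn_all; now apply run_result.
    - destruct (Hl (length l - S n)) as [b [E1 E2]]; [lia|].
      apply run_query with (1 := E1).
      assert (Hlt : length l - S n < length l) by lia.
      replace ((a :: firstn (length l - S n) l) ++ [beta b])
        with (a :: firstn (length l - n) l); [apply IH; lia|].
      replace (length l - n) with (S (length l - S n)) by lia.
      simpl; f_equal.
      now apply firstn_snoc. }
  specialize (Hd (length l) (le_n _)).
  now rewrite Nat.sub_diag in Hd.
- assert (H : forall l' s, run c alpha beta l' s -> forall l, l' = a :: l ->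
    interrogation c a alpha beta l -> phi c alpha beta a s).
  { induction 1 as [l' s E|l' b s E _ IH]; intros l -> Hl.
    - now exists l.
    - apply (IH (l ++ [beta b])); [reflexivity|].
      intros j; rewrite length_app; simpl; intros Hj.
      destruct (Nat.eq_dec j (length l)) as [->|ne].
      + exists b; split.
        * now rewrite firstn_app, firstn_all, Nat.sub_diag, app_nil_r.
        * rewrite nth_error_app2, Nat.sub_diag by lia; reflexivity.
      + destruct (Hl j) as [b' [E1 E2]]; [lia|].
        exists b'; split.
        * rewrite firstn_app.
          replace (j - length l) with 0 by lia.
          now rewrite app_nil_r.
        * rewrite nth_error_app1 by lia; exact E2. }
  intros Hr; apply (H _ _ Hr []); [reflexivity|].
  intros j Hj; simpl in Hj; lia.
Qed.

Lemma run_det (A : pca) (c : coding A) (alpha beta : A -> A) l r r' :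
  run c alpha beta l r -> run c alpha beta l r' -> r = r'.
Proof.
destruct (classic (exists x y : A, x <> y)) as [nt|triv].
2:{ intros _ _; apply NNPP; intros ne; apply triv; eauto. }
assert (ntf := tru_neq_fls (b:=c) nt).
intros H; revert r'; induction H as [l r E|l b r E _ IH]; intros r' H';
  inversion H' as [l0 r0 E'|l0 b' r0 E' Hb]; subst;
  rewrite E in E'; apply pair_inj in E'; destruct E' as [E1 E2]; subst;
  auto; now destruct ntf.
Qed.

Lemma phi_det (A : pca) (c : coding A) (alpha beta : A -> A) (a r r' : A) :
  phi c alpha beta a r -> phi c alpha beta a r' -> r = r'.
Proof. rewrite !phi_run; apply run_det. Qed.

Lemma K2_appP (A : pca) (c : coding A) (alpha beta f : A -> A) :
  K2_app c alpha beta = Some f <-> forall a, phi c alpha beta a (f a).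
Proof.
unfold K2_app.
destruct (excluded_middle_informative _) as [H|H]; split.
- intros E a; inversion E; subst.
  exact (proj2_sig (constructive_indefinite_description _ (H a))).
- intros Hf; f_equal; apply functional_extensionality; intros a.
  destruct (constructive_indefinite_description _ (H a)) as [r Hr]; simpl.
  exact (phi_det Hr (Hf a)).
- discriminate.
- intros Hf; destruct H; intros a; eauto.
Qed.

Lemma K2_app_run (A : pca) (c : coding A) (alpha beta f : A -> A) :
  K2_app c alpha beta = Some f <-> forall a, run c alpha beta [a] (f a).
Proof.
rewrite K2_appP; split; intros H a; apply phi_run, H.
Qed.

(** Well-founded interrogation strategies, against one or two oracles. *)
Inductive tree (A : Type) : Type :=
| Ret (r : A)
| Ask (b : A) (k : A -> tree A).

Fixpoint teval (A : Type) (t : tree A) (beta : A -> A) : A :=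
  match t with
  | Ret r => r
  | Ask b k => teval (k (beta b)) beta
  end.

Fixpoint follow (A : Type) (t : tree A) (l : list A) : tree A :=
  match t, l with
  | Ask b k, u :: l' => follow (k u) l'
  | _, _ => t
  end.

Inductive tree2 (A : Type) : Type :=
| Ret2 (r : A)
| AskL (b : A) (k : A -> tree2 A)
| AskR (b : A) (k : A -> tree2 A).
Arguments Ret2 {A} r.

Fixpoint teval2 (A : Type) (t : tree2 A) (alpha beta : A -> A) : A :=
  match t with
  | Ret2 r => r
  | AskL b k => teval2 (k (alpha b)) alpha beta
  | AskR b k => teval2 (k (beta b)) alpha beta
  end.

Fixpoint specL (A : Type) (t : tree2 A) (alpha : A -> A) : tree A :=
  match t with
  | Ret2 r => Ret r
  | AskL b k => specL (k (alpha b)) alpha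
  | AskR b k => Ask b (fun u => specL (k u) alpha)
  end.

Lemma teval_specL (A : Type) (t : tree2 A) (alpha beta : A -> A) :
  teval (specL t alpha) beta = teval2 t alpha beta.
Proof. induction t; simpl; auto. Qed.

Definition node (A : pca) (c : coding A) (t : tree A) : A :=
  match t with
  | Ret r => pair c (tru c) r
  | Ask b _ => pair c (fls c) b
  end.

Fixpoint followL (A : pca) (c : coding A) (t : tree2 A) (l : list A) : tree A :=
  match t with
  | Ret2 r => Ret (node c (Ret r))
  | AskL b k => Ask b (fun u => followL c (k u) l)
  | AskR b k =>
      match l with
      | [] => Ret (pair c (fls c) b)
      | u :: l' => followL c (k u) l'
      end
  end.

Lemma teval_followL (A : pca) (c : coding A) (t : tree2 A) (alpha : A -> A) l :
  teval (followL c t l) alpha = node c (follow (specL t alpha) l).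
Proof.
revert l; induction t as [r|b k IH|b k IH]; intros l; simpl;
  destruct l; simpl; auto.
Qed.

Definition decode (A : pca) (c : coding A) (x : A) : list A :=
  epsilon (inhabits []) (fun l => tup c l = x).

Lemma decodeK (A : pca) (c : coding A) (l : list A) :
  (exists a b : A, a <> b) -> decode c (tup c l) = l.
Proof.
intros nt; apply (tup_inj (c:=c) nt).
unfold decode; apply epsilon_spec; now exists l.
Qed.

(** For a one-level strategy [T], [enc T] is a function whose interrogations
    follow [T]. *)
Definition enc (A : pca) (c : coding A) (T : A -> tree A) (z : A) : A :=
  match decode c z with
  | [] => z
  | x :: l => node c (follow (T x) l)
  end.

Lemma enc_run (A : pca) (c : coding A) (T : A -> tree A) (beta : A -> A) x :
  (exists a b : A, a <> b) -> run c (enc c T) beta [x] (teval (T x) beta).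
Proof.
intros nt.
assert (H : forall t l, follow (T x) l = t ->
  run c (enc c T) beta (x :: l) (teval t beta)).
{ induction t as [r|b k IH]; intros l E; simpl.
  - apply run_result; unfold enc; rewrite decodeK by exact nt.
    now rewrite E.
  - apply run_query with b.
    + unfold enc; rewrite decodeK by exact nt; now rewrite E.
    + simpl; apply IH.
      revert E; generalize (T x) as t0; clear.
      induction l as [|u l IHl]; intros [r|b0 k0]; simpl;
        intros E; try discriminate; auto.
      inversion E; subst; now destruct (k (beta b)). }
apply H; now destruct (T x).
Qed.

Lemma curry2 (A : pca) (c : coding A) (D : A -> tree2 A) :
  (exists a b : A, a <> b) ->
  exists s, forall alpha, exists f, K2_app c s alpha = Some f /\
    forall beta, K2_app c f beta = Some (fun x => teval2 (D x) alpha beta).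
Proof.
intros nt.
pose (E z := match decode c z with
             | [] => Ret z
             | x :: l => followL c (D x) l end).
exists (enc c E); intros alpha.
exists (enc c (fun x => specL (D x) alpha)); split.
- apply K2_app_run; intros z.
  replace (enc c (fun x => specL (D x) alpha) z) with (teval (E z) alpha).
  + now apply enc_run.
  + unfold E, enc; destruct (decode c z); simpl; auto.
    apply teval_followL.
- intros beta; apply K2_app_run; intros x.
  rewrite <- teval_specL; exact (@enc_run A c (fun x => specL (D x) alpha) beta x nt).
Qed.

(** The element [s] of [K2]: to compute [(alpha gamma) (beta gamma)] at [a], a
    machine first checks that [alpha gamma] and [beta gamma] are defined at [a]
    and then simulates the interrogation of [beta gamma] by [alpha gamma].  Each
    step consults [alpha] or [beta] once and then [gamma] once, so that the
    number of consultations of [alpha] and [beta] is bounded by the number of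
    answers of [gamma]. *)
Inductive state (A : Type) : Type :=
| ChkL (l : list A)
| ChkR (l : list A)
| Outer (L l : list A)
| Inner (L l : list A)
| Stuck
| Done (r : A).
Arguments Stuck {A}.

Section SMachine.
Context (A : pca) (c : coding A) (nt : exists a b : A, a <> b).

Definition by_mark (B : Type) (v : A) (fl ft : A -> B) (d : B) : B :=
  match excluded_middle_informative (exists b, v = pair c (fls c) b) with
  | left H => fl (proj1_sig (constructive_indefinite_description _ H))
  | right _ =>
    match excluded_middle_informative (exists b, v = pair c (tru c) b) with
    | left H => ft (proj1_sig (constructive_indefinite_description _ H))
    | right _ => d
    end
  end.

Lemma by_mark_fls B b (fl ft : A -> B) d : by_mark (pair c (fls c) b) fl ft d = fl b.
Proof.
unfold by_mark; destruct (excluded_middle_informative _) as [H|H].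
- destruct (constructive_indefinite_description _ H) as [b' E]; simpl.
  apply pair_inj in E; now destruct E as [_ ->].
- destruct H; eauto.
Qed.

Lemma by_mark_tru B b (fl ft : A -> B) d : by_mark (pair c (tru c) b) fl ft d = ft b.
Proof.
unfold by_mark; destruct (excluded_middle_informative _) as [[b' E]|_].
- exfalso; apply pair_inj in E; destruct (tru_neq_fls (b:=c) nt); tauto.
- destruct (excluded_middle_informative _) as [H|H].
  + destruct (constructive_indefinite_description _ H) as [b' E]; simpl.
    apply pair_inj in E; now destruct E as [_ ->].
  + destruct H; eauto.
Qed.

Lemma by_markP v : (exists b, v = pair c (fls c) b) \/
  (exists b, v = pair c (tru c) b) \/
  (forall B (fl ft : A -> B) d, by_mark v fl ft d = d).
Proof.
destruct (classic (exists b, v = pair c (fls c) b)) as [H|H]; [auto|].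
destruct (classic (exists b, v = pair c (tru c) b)) as [H'|H']; [auto|].
right; right; intros; unfold by_mark.
destruct (excluded_middle_informative _); [tauto|].
destruct (excluded_middle_informative _); [tauto|reflexivity].
Qed.

Definition probe (s : state A) (k : A -> tree2 A) : tree2 A :=
  match s with
  | ChkL l | Outer _ l => AskL (tup c l) k
  | ChkR l | Inner _ l => AskR (tup c l) k
  | Stuck => k (tup c [])
  | Done _ => k (tup c [])
  end.

Definition answer (alpha beta : A -> A) (s : state A) : A :=
  match s with
  | ChkL l | Outer _ l => alpha (tup c l)
  | ChkR l | Inner _ l => beta (tup c l)
  | Stuck | Done _ => tup c []
  end.

Definition act (a : A) (s : state A) (v : A) : A * (A -> state A) :=
  match s with
  | ChkL l => by_mark v (fun b => (b, fun w => ChkL (l ++ [w])))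
                      (fun _ => (a, fun _ => ChkR [a])) (a, fun _ => Stuck)
  | ChkR l => by_mark v (fun b => (b, fun w => ChkR (l ++ [w])))
                      (fun _ => (a, fun _ => Outer [a] [tup c [a]]))
                      (a, fun _ => Stuck)
  | Outer L l =>
      by_mark v (fun b => (b, fun w => Outer L (l ++ [w])))
              (fun r => (a, fun _ => by_mark r (fun b => Inner L [b]) (@Done A) Stuck))
              (a, fun _ => Stuck)
  | Inner L l =>
      by_mark v (fun b => (b, fun w => Inner L (l ++ [w])))
              (fun r => (a, fun _ => Outer (L ++ [r]) [tup c (L ++ [r])]))
              (a, fun _ => Stuck)
  | Stuck => (a, fun _ => Stuck)
  | Done r => (a, fun _ => Done r)
  end.

Fixpoint walk (a : A) (s : state A) (ws : list A) : tree2 A :=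
  match s with
  | Done r => Ret2 (pair c (tru c) r)
  | _ => probe s (fun v =>
           match ws with
           | [] => Ret2 (pair c (fls c) (fst (act a s v)))
           | w :: ws' => walk a (snd (act a s v) w) ws'
           end)
  end.

Definition Stree (z : A) : tree2 A :=
  match decode c z with
  | [] => Ret2 z
  | a :: ws => walk a (ChkL [a]) ws
  end.

Context (alpha beta gamma : A -> A).

Definition move (a : A) (s : state A) : A * (A -> state A) :=
  act a s (answer alpha beta s).

Definition out (a : A) (s : state A) : A :=
  match s with
  | Done r => pair c (tru c) r
  | _ => pair c (fls c) (fst (move a s))
  end.

Definition next (a : A) (s : state A) (w : A) : state A := snd (move a s) w.

Definition after (a : A) (s : state A) (ws : list A) : state A :=
  fold_left (next a) ws s.

Lemma after_done a r ws : after a (Done r) ws = Done r.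
Proof. induction ws; simpl; auto. Qed.

Lemma teval_walk a s ws :
  teval2 (walk a s ws) alpha beta = out a (after a s ws).
Proof.
revert s; induction ws as [|w ws IH]; intros s.
- now destruct s.
- destruct s as [l|l|L l|L l| |r]; try exact (IH _).
  now rewrite after_done.
Qed.

Inductive mrun (a : A) : state A -> A -> Prop :=
| mrun_done r : mrun a (Done r) r
| mrun_step s r : (forall r', s <> Done r') ->
    mrun a (next a s (gamma (fst (move a s)))) r -> mrun a s r.

Let g z := teval2 (Stree z) alpha beta.

Lemma g_tup a ws : g (tup c (a :: ws)) = out a (after a (ChkL [a]) ws).
Proof. unfold g, Stree; rewrite decodeK by exact nt; apply teval_walk. Qed.

Lemma out_tru a s r : out a s = pair c (tru c) r -> s = Done r.
Proof.
destruct s; simpl; intros E; apply pair_inj in E; destruct E as [E1 E2];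
  try (now symmetry in E1; destruct (tru_neq_fls (b:=c) nt)).
now subst.
Qed.

Lemma g_mrun a r : run c g gamma [a] r <-> mrun a (ChkL [a]) r.
Proof.
split.
- assert (H : forall l r, run c g gamma l r -> forall ws, l = a :: ws ->
    mrun a (after a (ChkL [a]) ws) r).
  { clear r; induction 1 as [l r E|l b r E _ IH]; intros ws ->.
    - rewrite g_tup in E; rewrite (out_tru E); constructor.
    - specialize (IH (ws ++ [gamma b]) eq_refl).
      rewrite g_tup in E.
      unfold after in IH |- *; rewrite fold_left_app in IH; simpl in IH.
      fold (after a (ChkL [a]) ws) in IH, E |- *.
      destruct (after a (ChkL [a]) ws) eqn:Es; simpl in E;
        apply pair_inj in E; destruct E as [E1 E2];
        try (now destruct (tru_neq_fls (b:=c) nt));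
        (apply mrun_step; [discriminate|]; now subst b). }
  intros Hr; exact (H _ _ Hr [] eq_refl).
- assert (H : forall s r, mrun a s r -> forall ws, s = after a (ChkL [a]) ws ->
    run c g gamma (a :: ws) r).
  { clear r; induction 1 as [r|s r nd _ IH]; intros ws Es.
    - apply run_result; rewrite g_tup, <- Es; reflexivity.
    - apply run_query with (fst (move a s)).
      + rewrite g_tup, <- Es.
        destruct s; try reflexivity; now destruct (nd r0).
      + apply (IH (ws ++ [gamma (fst (move a s))])).
        unfold after; rewrite fold_left_app; simpl.
        now rewrite Es. }
  intros Hr; exact (H _ _ Hr [] eq_refl).
Qed.

Lemma mrun_inv a s r : mrun a s r -> (forall r', s <> Done r') ->
  mrun a (next a s (gamma (fst (move a s)))) r.
Proof. intros H nd; inversion H; subst; auto; now destruct (nd r). Qed.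

Lemma mrun_stuck a r : ~ mrun a Stuck r.
Proof.
intros H; remember Stuck as s eqn:Es; induction H; [discriminate|].
apply IHmrun; now subst s.
Qed.

(** In each phase, the machine runs the corresponding interrogation. *)
Definition phase (alpha' : A -> A) (a : A) (st : list A -> state A)
    (fin : A -> state A) : Prop :=
  forall l,
    (forall r', st l <> Done r') /\
    move a (st l) =
      by_mark (alpha' (tup c l)) (fun b => (b, fun w => st (l ++ [w])))
        (fun v => (a, fun _ => fin v)) (a, fun _ => Stuck).

Lemma phase_run alpha' a st fin : phase alpha' a st fin ->
  forall l v r, run c alpha' gamma l v -> mrun a (fin v) r -> mrun a (st l) r.
Proof.
intros Hp l v r H Hv; induction H as [l v E|l b v E _ IH];
  destruct (Hp l) as [nd Em]; apply mrun_step; auto; unfold next; rewrite Em, E.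
- now rewrite by_mark_tru.
- rewrite by_mark_fls; simpl; auto.
Qed.

Inductive mrunn (a : A) : nat -> state A -> A -> Prop :=
| mrunn_done n r : mrunn a n (Done r) r
| mrunn_step n s r : (forall r', s <> Done r') ->
    mrunn a n (next a s (gamma (fst (move a s)))) r -> mrunn a (S n) s r.

Lemma mrun_mrunn a s r : mrun a s r -> exists n, mrunn a n s r.
Proof.
induction 1 as [r|s r nd _ [n IH]].
- exists 0; constructor.
- exists (S n); now constructor.
Qed.

Lemma mrunn_stuck a n r : ~ mrunn a n Stuck r.
Proof. induction n; intros H; inversion H; subst; auto. Qed.

Lemma phase_mrunn alpha' a st fin : phase alpha' a st fin ->
  forall n l r, mrunn a n (st l) r ->
  exists v m, m < n /\ run c alpha' gamma l v /\ mrunn a m (fin v) r.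
Proof.
intros Hp; induction n as [|n IH]; intros l r H;
  destruct (Hp l) as [nd Em].
- inversion H; subst; match goal with E : Done _ = _ |- _ =>
    symmetry in E; now destruct (nd _ E) end.
- inversion H as [n' r' E1 E2 E3|n' s r' nd' H' E1 E2 E3]; subst.
  { symmetry in E2; now destruct (nd _ E2). }
  unfold next in H'; rewrite Em in H'.
  destruct (by_markP (alpha' (tup c l))) as [[b E]|[[b E]|E]].
  + rewrite E, by_mark_fls in H'; simpl in H'.
    destruct (IH _ _ H') as [v [m [Hm [Hr Hf]]]].
    exists v, m; split; [lia|]; split; auto.
    now apply run_query with b.
  + rewrite E, by_mark_tru in H'; simpl in H'.
    exists b, n; split; [lia|]; split; auto; now constructor.
  + rewrite E in H'; simpl in H'; now destruct (mrunn_stuck H').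
Qed.

Lemma phase_ChkL a : phase alpha a (@ChkL A) (fun _ => ChkR [a]).
Proof. intros l; split; [discriminate|reflexivity]. Qed.

Lemma phase_ChkR a : phase beta a (@ChkR A) (fun _ => Outer [a] [tup c [a]]).
Proof. intros l; split; [discriminate|reflexivity]. Qed.

Lemma phase_Outer a L : phase alpha a (Outer L)
  (fun v => by_mark v (fun b => Inner L [b]) (@Done A) Stuck).
Proof. intros l; split; [discriminate|reflexivity]. Qed.

Lemma phase_Inner a L : phase beta a (Inner L)
  (fun v => Outer (L ++ [v]) [tup c (L ++ [v])]).
Proof. intros l; split; [discriminate|reflexivity]. Qed.

Lemma mrun_defined a r : mrun a (ChkL [a]) r ->
  exists u v n, run c alpha gamma [a] u /\ run c beta gamma [a] v /\
    mrunn a n (Outer [a] [tup c [a]]) r.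
Proof.
intros H; apply mrun_mrunn in H; destruct H as [n H].
destruct (phase_mrunn (phase_ChkL a) H) as [u [m [_ [Hu H']]]].
destruct (phase_mrunn (phase_ChkR a) H') as [v [p [_ [Hv H'']]]].
eauto 10.
Qed.

Lemma mrunn_outer (f h : A -> A) :
  (forall x, run c alpha gamma [x] (f x)) ->
  (forall x, run c beta gamma [x] (h x)) ->
  forall a n L r, mrunn a n (Outer L [tup c L]) r -> run c f h L r.
Proof.
intros Hf Hh a n; induction n as [n IH] using lt_wf_ind; intros L r H.
destruct (phase_mrunn (@phase_Outer a L) H) as [v [m [Hm [Hv H']]]].
apply (run_det (Hf _)) in Hv.
destruct (by_markP v) as [[b E]|[[b E]|E]].
- rewrite E, by_mark_fls in H'.
  destruct (phase_mrunn (@phase_Inner a L) H') as [w [p [Hp [Hw H'']]]].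
  apply (run_det (Hh _)) in Hw; subst w.
  apply run_query with b; [congruence|].
  apply (IH p); [lia|exact H''].
- rewrite E, by_mark_tru in H'.
  inversion H'; subst; [|now destruct (H0 b)].
  apply run_result; congruence.
- rewrite E in H'; now destruct (mrunn_stuck H').
Qed.

Lemma mrun_outer (f h : A -> A) :
  (forall x, run c alpha gamma [x] (f x)) ->
  (forall x, run c beta gamma [x] (h x)) ->
  forall a L r, run c f h L r -> mrun a (Outer L [tup c L]) r.
Proof.
intros Hf Hh a L r H; induction H as [L r E|L b r E _ IH];
  apply (phase_run (@phase_Outer a L) (Hf _)); rewrite E.
- rewrite by_mark_tru; constructor.
- rewrite by_mark_fls; exact (phase_run (@phase_Inner a L) (Hh _) IH).
Qed.

Lemma Stree_app : K2_app c g gamma =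
  lift_app (K2_app c) (K2_app c alpha gamma) (K2_app c beta gamma).
Proof.
destruct (K2_app c g gamma) as [q|] eqn:Eq.
- rewrite K2_app_run in Eq.
  assert (H := fun a => mrun_defined (proj1 (g_mrun a _) (Eq a))).
  destruct (K2_app c alpha gamma) as [f|] eqn:Ef.
  2:{ exfalso; revert Ef; unfold K2_app.
      destruct (excluded_middle_informative _) as [T|N]; [discriminate|].
      destruct N; intros a; destruct (H a) as [u [_ [_ [Hu _]]]].
      exists u; now apply phi_run. }
  destruct (K2_app c beta gamma) as [h|] eqn:Eh.
  2:{ exfalso; revert Eh; unfold K2_app.
      destruct (excluded_middle_informative _) as [T|N]; [discriminate|].
      destruct N; intros a; destruct (H a) as [_ [v [_ [_ [Hv _]]]]].
      exists v; now apply phi_run. }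
  rewrite K2_app_run in Ef, Eh; simpl; symmetry; apply K2_app_run.
  intros a; destruct (H a) as [_ [_ [n [_ [_ Hn]]]]].
  exact (mrunn_outer Ef Eh Hn).
- destruct (K2_app c alpha gamma) as [f|] eqn:Ef; [|reflexivity].
  destruct (K2_app c beta gamma) as [h|] eqn:Eh; [|reflexivity].
  simpl; destruct (K2_app c f h) as [q|] eqn:E; [|reflexivity].
  rewrite <- Eq; apply K2_app_run; intros a; apply g_mrun.
  rewrite K2_app_run in Ef, Eh, E.
  apply (phase_run (phase_ChkL a) (Ef a)).
  apply (phase_run (phase_ChkR a) (Eh a)).
  exact (mrun_outer Ef Eh a (E a)).
Qed.

End SMachine.

Lemma K2_app_trivial (A : pca) (c : coding A) (alpha beta f : A -> A) :
  ~ (exists a b : A, a <> b) -> K2_app c alpha beta = Some f.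
Proof.
intros triv; apply K2_app_run; intros a; apply run_result.
apply NNPP; intros ne; apply triv; eauto.
Qed.

Lemma K2_k (A : pca) (c : coding A) : exists k : A -> A,
  forall x y, lift_app (K2_app c) (K2_app c k x) (Some y) = Some x.
Proof.
destruct (classic (exists a b : A, a <> b)) as [nt|triv].
- destruct (curry2 c (fun x => AskL x Ret2) nt) as [k Hk].
  exists k; intros x y; destruct (Hk x) as [f [-> Hf]]; exact (Hf y).
- exists (fun x => x); intros x y.
  rewrite (K2_app_trivial c (fun x => x) x x triv); now apply K2_app_trivial.
Qed.

Lemma K2_s (A : pca) (c : coding A) : exists s : A -> A,
  (forall x y, lift_app (K2_app c) (K2_app c s x) (Some y) <> None) /\
  (forall x y z,
     lift_app (K2_app c) (lift_app (K2_app c) (K2_app c s x) (Some y)) (Some z) =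
     lift_app (K2_app c) (K2_app c x z) (K2_app c y z)).
Proof.
destruct (classic (exists a b : A, a <> b)) as [nt|triv].
- destruct (curry2 c (Stree c) nt) as [s Hs].
  exists s; split; intros x y.
  + destruct (Hs x) as [f [-> Hf]]; simpl; rewrite Hf; discriminate.
  + intros z; destruct (Hs x) as [f [-> Hf]]; simpl; rewrite Hf; simpl.
    now apply Stree_app.
- assert (T : forall x y, K2_app c x y = Some (fun x => x)).
  { intros; now apply K2_app_trivial. }
  exists (fun x => x); split; intros x y; rewrite !T; simpl; rewrite !T;
    [discriminate|].
  intros z; rewrite !T; simpl; now rewrite !T.
Qed.

Definition K2 (A : pca) (c : coding A) : pca :=
  @Pca (A -> A) (K2_app c) (K2_k c) (K2_s c).

Definition is_applicative (X Y : pca) (g : X -> Y -> Prop) : Prop :=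
  (forall x, exists y, g x y) /\
  exists t : Y, forall (x x' xx' : X) (y y' : Y),
    g x y -> g x' y' -> x • x' = xx' ->
    exists z : Y, t • y • y' = z /\ g xx' z.

Definition comp_morph (X Y Z : pca) (e : Y -> Z -> Prop) (g : X -> Y -> Prop) :
  X -> Z -> Prop := fun x z => exists y, g x y /\ e y z.

Definition preceq (X Y : pca) (g g' : X -> Y -> Prop) : Prop :=
  exists t : Y, forall x (y : Y), g x y -> exists z : Y, t • y = z /\ g' x z.

Definition iso_morph (X Y : pca) (g g' : X -> Y -> Prop) : Prop :=
  preceq g g' /\ preceq g' g.

Definition decidable_morph (X Y : pca) (bX : booleans X) (bY : booleans Y)
    (g : X -> Y -> Prop) : Prop :=
  exists d : Y,
    (forall y : Y, g (tru bX) y -> d • y = tru bY) /\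
    (forall y : Y, g (fls bX) y -> d • y = fls bY).

Definition representable (X Y : pca) (g : X -> Y -> Prop) (f : X -> option X) :
    Prop :=
  exists r : Y, forall (x x' : X) (y : Y),
    f x = Some x' -> g x y -> exists z : Y, r • y = z /\ g x' z.

Definition const_morph (A : pca) (c : coding A) (a : A) (alpha : K2 c) : Prop :=
  alpha = (fun _ => a).

Arguments const_morph {A} c a alpha.

Lemma const_morph_applicative (A : pca) (c : coding A) :
  is_applicative (const_morph c).
Proof.
split; [intros a; now exists (fun _ => a : A)|].
destruct (classic (exists a b : A, a <> b)) as [nt|triv].
- destruct (curry2 c (fun x => AskL x (fun u => AskR x (fun v =>
      Ret2 (match papp u v with Some w => w | None => x end)))) nt) as [t Ht].
  exists t; intros a a' aa' y y' -> -> E; unfold val, oapp in *; simpl in *.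
  destruct (Ht (fun _ => a)) as [f [-> Hf]]; simpl; rewrite Hf; simpl.
  rewrite E; now eexists; split.
- exists (fun x => x); intros a a' aa' y y' -> -> E; unfold val, oapp; simpl.
  rewrite (K2_app_trivial c (fun x => x) _ (fun x => x) triv); simpl.
  rewrite (K2_app_trivial c (fun x => x) _ (fun _ => aa') triv); now eexists; split.
Qed.

Module CodingExists.

Section Codings.
Context (X : pca).

Inductive exp : Type :=
| V (i : nat)
| Q (x : X)
| Ap (e f : exp).

Definition scons (x : X) (env : nat -> X) (i : nat) : X :=
  match i with 0 => x | S j => env j end.

Fixpoint den (env : nat -> X) (e : exp) : option X :=
  match e with
  | V i => val (env i)
  | Q x => val x
  | Ap e f => den env e • den env f
  end.

Fixpoint shift (e : exp) : exp :=
  match e with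
  | V i => V (S i)
  | Q x => Q x
  | Ap e f => Ap (shift e) (shift f)
  end.

Lemma den_shift x env e : den (scons x env) (shift e) = den env e.
Proof. induction e as [i|y|e IHe f IHf]; simpl; congruence. Qed.

Lemma combinators : exists k s : X,
  (forall x y : X, k • x • y = x) /\
  (forall x y : X, exists u : X, s • x • y = u) /\
  (forall x y z : X, s • x • y • z = (x • z) • (y • z)).
Proof.
destruct (pca_k X) as [k Hk], (pca_s X) as [s [Hs Hs']].
exists k, s; repeat split; auto.
intros x y; specialize (Hs x y); unfold val, oapp; simpl.
destruct (lift_app _ _ _) as [u|]; [now exists u|easy].
Qed.

Lemma abstraction : exists abs : exp -> exp, forall env e,
  exists r : X, den env (abs e) = r /\
    forall x : X, r • x = den (scons x env) e.
Proof.
destruct combinators as [k [s [Hk [Hs Hs']]]].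
assert (Hk1 : forall x : X, exists u : X, k • x = u).
{ intros x; specialize (Hk x x); destruct (k • x) as [u|]; [now exists u|easy]. }
exists (fix abs e := match e with
  | V 0 => Ap (Ap (Q s) (Q k)) (Q k)
  | V (S i) => Ap (Q k) (V i)
  | Q x => Ap (Q k) (Q x)
  | Ap e f => Ap (Ap (Q s) (abs e)) (abs f)
  end).
intros env e; induction e as [[|i]|y|e [r [Er Hr]] f [q [Eq Hq]]].
- destruct (Hs k k) as [u Hu]; exists u; split; [exact Hu|].
  intros x; rewrite <- Hu, Hs'; cbn [den scons].
  destruct (Hk1 x) as [v Hv]; transitivity (k • x • v); [now rewrite Hv|apply Hk].
- destruct (Hk1 (env i)) as [u Hu]; exists u; split; [exact Hu|].
  intros x; rewrite <- Hu; apply Hk.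
- destruct (Hk1 y) as [u Hu]; exists u; split; [exact Hu|].
  intros x; rewrite <- Hu; apply Hk.
- destruct (Hs r q) as [u Hu]; exists u; split.
  + cbn [den]; rewrite Er, Eq; exact Hu.
  + intros x; rewrite <- Hu, Hs', Hr, Hq; reflexivity.
Qed.

Lemma empty_env : exists env : nat -> X, True.
Proof. destruct (pca_point X) as [x _]; now exists (fun _ => x). Qed.

Lemma lam1 e : exists (env : nat -> X) (r : X),
  forall x : X, r • x = den (scons x env) e.
Proof.
destruct empty_env as [env _], abstraction as [abs H].
destruct (H env e) as [r [_ Hr]]; now exists env, r.
Qed.

Lemma lam2 e : exists (env : nat -> X) (r : X), forall x : X,
  exists r' : X, r • x = r' /\
  forall y : X, r' • y = den (scons y (scons x env)) e.
Proof.
destruct empty_env as [env _], abstraction as [abs H].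
destruct (H env (abs e)) as [r [_ Hr]]; exists env, r; intros x.
destruct (H (scons x env) e) as [r' [E Hr']].
exists r'; rewrite Hr; auto.
Qed.

Lemma lam3 e : exists (env : nat -> X) (r : X), forall x y : X,
  exists r' : X, r • x • y = r' /\
  forall z : X, r' • z = den (scons z (scons y (scons x env))) e.
Proof.
destruct empty_env as [env _], abstraction as [abs H].
destruct (H env (abs (abs e))) as [r [_ Hr]]; exists env, r; intros x y.
destruct (H (scons x env) (abs e)) as [r' [E Hr']].
destruct (H (scons y (scons x env)) e) as [r'' [E' Hr'']].
exists r''; rewrite Hr, E, Hr'; auto.
Qed.

Lemma fixpoint e : exists (env : nat -> X) (r : X),
  forall x : X, r • x = den (scons x (scons r env)) e.
Proof.
destruct (lam2 e) as [env [F HF]].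
destruct (lam2 (Ap (Ap (Q F) (Ap (V 1) (V 1))) (V 0))) as [env' [w Hw]].
destruct (Hw w) as [r [Er Hr]]; exists env, r; intros x.
rewrite Hr; cbn [den scons]; rewrite Er.
destruct (HF r) as [r' [Er' Hr']]; now rewrite Er', Hr'.
Qed.

Lemma booleans_pairing : exists (b : booleans X) (pr : X) (pair : X -> X -> X),
  (forall x y : X, pr • x • y = pair x y) /\
  forall x y z : X, pair x y • z = z • x • y.
Proof.
destruct (lam2 (V 1)) as [e1 [tt Ht]], (lam2 (V 0)) as [e2 [ff Hf]].
destruct (lam1 (V 0)) as [e3 [C HC]].
assert (Bt : forall a b : X, C • tt • a • b = a).
{ intros a b; rewrite HC; cbn [den scons].
  destruct (Ht a) as [u [-> Hu]]; apply Hu. }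
assert (Bf : forall a b : X, C • ff • a • b = b).
{ intros a b; rewrite HC; cbn [den scons].
  destruct (Hf a) as [u [-> Hu]]; apply Hu. }
destruct (lam3 (Ap (Ap (V 0) (V 2)) (V 1))) as [e4 [pr Hp]].
exists (Booleans Bt Bf), pr.
exists (fun x y => proj1_sig (constructive_indefinite_description _ (Hp x y))).
split; intros x y; destruct (constructive_indefinite_description _ _)
  as [r [Er Hr]]; simpl; auto.
Qed.

Context (b : booleans X) (pr : X) (pair : X -> X -> X).
Context (pr_pair : forall x y : X, pr • x • y = pair x y).
Context (pair_app : forall x y z : X, pair x y • z = z • x • y).

Lemma projections : exists pr0 pr1 : X,
  (forall x y : X, pr0 • pair x y = x) /\ (forall x y : X, pr1 • pair x y = y).
Proof.
destruct (lam2 (V 1)) as [e1 [tt Ht]], (lam2 (V 0)) as [e2 [ff Hf]].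
destruct (lam1 (Ap (V 0) (Q tt))) as [e3 [pr0 H0]].
destruct (lam1 (Ap (V 0) (Q ff))) as [e4 [pr1 H1]].
exists pr0, pr1; split; intros x y.
- rewrite H0; cbn [den scons]; rewrite pair_app.
  destruct (Ht x) as [u [-> Hu]]; apply Hu.
- rewrite H1; cbn [den scons]; rewrite pair_app.
  destruct (Hf x) as [u [-> Hu]]; apply Hu.
Qed.

Lemma conditional : exists If : exp -> exp -> exp -> exp,
  (forall env e f g, den env e = tru b -> den env (If e f g) = den env f) /\
  (forall env e f g, den env e = fls b -> den env (If e f g) = den env g).
Proof.
destruct abstraction as [abs H].
exists (fun e f g => Ap (Ap (Ap (Ap (Q (cond b)) e) (abs (shift f)))
                        (abs (shift g))) (Q pr)).
split; intros env e f g E; cbn [den]; rewrite E;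
  destruct (H env (shift f)) as [u [-> Hu]], (H env (shift g)) as [v [-> Hv]].
- rewrite cond_tru, Hu; apply den_shift.
- rewrite cond_fls, Hv; apply den_shift.
Qed.

Context (pr0 pr1 : X) (If : exp -> exp -> exp -> exp).
Context (pr0_pair : forall x y : X, pr0 • pair x y = x).
Context (pr1_pair : forall x y : X, pr1 • pair x y = y).
Context (If_tru : forall env e f g,
  den env e = tru b -> den env (If e f g) = den env f).
Context (If_fls : forall env e f g,
  den env e = fls b -> den env (If e f g) = den env g).

Fixpoint cnum (n : nat) : X :=
  match n with
  | 0 => pair (tru b) (tru b)
  | S m => pair (fls b) (cnum m)
  end.

Fixpoint clist (l : list X) : X :=
  match l with
  | [] => tru b
  | x :: l' => pair x (clist l')
  end.

Definition ctup (l : list X) : X := pair (cnum (length l)) (clist l).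

Lemma val_inj (x y : X) : val x = val y -> x = y.
Proof. intros E; now inversion E. Qed.

Lemma cpair_inj x y x' y' : pair x y = pair x' y' -> x = x' /\ y = y'.
Proof.
intros E; split; apply val_inj.
- now rewrite <- pr0_pair with (y := y), E, pr0_pair.
- now rewrite <- pr1_pair with (x := x), E, pr1_pair.
Qed.

Lemma cnum_inj : (exists x y : X, x <> y) -> Injective cnum.
Proof.
intros nt n; induction n as [|n IH]; intros [|m] E; auto;
  apply cpair_inj in E; destruct E as [E1 E2].
- now destruct (tru_neq_fls nt E1).
- symmetry in E1; now destruct (tru_neq_fls nt E1).
- now rewrite (IH _ E2).
Qed.

Lemma ctup_inj : (exists x y : X, x <> y) -> Injective ctup.
Proof.
intros nt u v E; apply cpair_inj in E; destruct E as [E1 E2].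
apply (cnum_inj nt) in E1; revert v E1 E2.
induction u as [|x u IH]; intros [|y v] E1 E2; try discriminate; auto.
apply cpair_inj in E2; destruct E2 as [-> E2].
f_equal; apply IH; auto.
Qed.

Notation "'P0' e" := (Ap (Q pr0) e) (at level 8, e at level 7).
Notation "'P1' e" := (Ap (Q pr1) e) (at level 8, e at level 7).
Notation PR e f := (Ap (Ap (Q pr) e) f).

Ltac ev := cbn [den scons cnum clist map length List.app];
  repeat (rewrite pr0_pair || rewrite pr1_pair || rewrite pr_pair).

Lemma prog_rect' (P : prog -> Prop) :
  P Zero -> P Succ -> (forall i, P (Proj i)) ->
  (forall f gs, P f -> Forall P gs -> P (Comp f gs)) ->
  (forall f g, P f -> P g -> P (Prec f g)) ->
  (forall f, P f -> P (Mu f)) -> forall e, P e.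
Proof.
intros H1 H2 H3 H4 H5 H6.
fix IH 1; intros [| |i|f gs|f g|f].
- exact H1.
- exact H2.
- apply H3.
- apply H4; [apply IH|].
  induction gs as [|g gs IHgs]; constructor; [apply IH|exact IHgs].
- apply H5; apply IH.
- apply H6; apply IH.
Qed.

Definition cargs (v : list nat) : X := clist (map cnum v).

Lemma computable_list (e : prog) : exists r : X, forall v m,
  computes e v m -> r • cargs v = cnum m.
Proof.
induction e as [| |i|f gs [r Hr] Hgs|f g [r Hr] [q Hq]|f [r Hr]]
  using prog_rect'.
- destruct (lam1 (Q (cnum 0))) as [env [r Hr]]; exists r; intros v m H.
  inversion H; subst; apply Hr.
- destruct (lam1 (PR (Q (fls b)) (P0 (V 0)))) as [env [r Hr]].
  exists r; intros v m H; inversion H; subst.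
  rewrite Hr; unfold cargs; now ev.
- assert (H : exists r : X, forall v m, nth_error v i = Some m ->
    r • cargs v = cnum m).
  { induction i as [|i [r Hr]].
    - exists pr0; intros [|n v] m E; inversion E; subst.
      unfold cargs; now ev.
    - destruct (lam1 (Ap (Q r) (P1 (V 0)))) as [env [q Hq]].
      exists q; intros [|n v] m E; [discriminate|].
      rewrite Hq; unfold cargs; ev; now apply Hr. }
  destruct H as [r Hr]; exists r; intros v m H; inversion H; auto.
- assert (H : exists G : X, forall v w,
    Forall2 (fun g y => computes g v y) gs w -> G • cargs v = cargs w).
  { clear r Hr; induction Hgs as [|g gs [r Hr] _ [G HG]].
    - destruct (lam1 (Q (tru b))) as [env [G HG]]; exists G; intros v w H.
      inversion H; subst; apply HG.
    - destruct (lam1 (PR (Ap (Q r) (V 0)) (Ap (Q G) (V 0)))) as [env [q Hq]].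
      exists q; intros v w H; inversion H as [|g' y gs' w' Hy Hw]; subst.
      rewrite Hq; cbn [den scons].
      rewrite (Hr _ _ Hy), (HG _ _ Hw); unfold cargs; now ev. }
  destruct H as [G HG].
  destruct (lam1 (Ap (Q r) (Ap (Q G) (V 0)))) as [env [q Hq]].
  exists q; intros v m H; inversion H; subst.
  rewrite Hq; cbn [den scons]; erewrite HG by eassumption; auto.
- destruct (fixpoint (If (P0 (P0 (V 0))) (Ap (Q r) (P1 (V 0)))
    (Ap (Q q) (PR (P1 (P0 (V 0)))
       (PR (Ap (V 1) (PR (P1 (P0 (V 0))) (P1 (V 0)))) (P1 (V 0)))))))
    as [env [h Hh]].
  exists h.
  assert (H : forall n v m, computes (Prec f g) (n :: v) m ->
    h • cargs (n :: v) = cnum m).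
  { induction n as [|n IH]; intros v m H; inversion H; subst; rewrite Hh.
    - rewrite If_tru by (unfold cargs; now ev).
      unfold cargs; ev; now apply Hr.
    - rewrite If_fls by (unfold cargs; now ev).
      match goal with Hc : computes (Prec f g) _ _ |- _ =>
        apply IH in Hc; unfold cargs in Hc |- *; ev;
        cbn [map clist] in Hc; rewrite Hc end.
      ev; match goal with Hc : computes g _ _ |- _ => apply Hq in Hc;
        exact Hc end. }
  intros v m Hc; destruct v as [|n v]; [inversion Hc|auto].
- destruct (fixpoint (If (P0 (Ap (Q r) (V 0))) (P0 (V 0))
    (Ap (V 1) (PR (PR (Q (fls b)) (P0 (V 0))) (P1 (V 0)))))) as [env [h Hh]].
  destruct (lam1 (Ap (Q h) (PR (Q (cnum 0)) (V 0)))) as [env' [q Hq]].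
  exists q; intros v m H; inversion H as [| | | | | |f' v' m' H0 Hlt]; subst.
  rewrite Hq; ev.
  assert (Hd : forall d i, i + d = m -> h • cargs (i :: v) = cnum m).
  { induction d as [|d IH]; intros i E; rewrite Hh.
    - replace i with m by lia.
      rewrite If_tru.
      + unfold cargs; now ev.
      + cbn [den scons]; rewrite (Hr _ _ H0); now ev.
    - rewrite If_fls.
      + rewrite <- (IH (S i)) by lia; unfold cargs; now ev.
      + destruct (Hlt i) as [j Hj]; [lia|].
        cbn [den scons]; rewrite (Hr _ _ Hj); now ev. }
  exact (Hd m 0 eq_refl).
Qed.

Lemma uncurry n : exists D : X, forall R : X, exists r : X, D • R = r /\
  forall x l, length l = n -> apps r (x :: l) = R • clist (x :: l).
Proof.
induction n as [|n [D HD]].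
- destruct (lam2 (Ap (V 1) (PR (V 0) (Q (tru b))))) as [env [D HD]].
  exists D; intros R; destruct (HD R) as [r [Er Hr]].
  exists r; split; auto; intros x [|y l] E; [|discriminate].
  unfold apps; cbn [fold_left]; rewrite Hr; now ev.
- destruct (lam3 (Ap (V 2) (PR (V 1) (V 0)))) as [env [B HB]].
  destruct (lam2 (Ap (Q D) (Ap (Ap (Q B) (V 1)) (V 0)))) as [env' [D' HD']].
  exists D'; intros R; destruct (HD' R) as [r [Er Hr]].
  exists r; split; auto; intros x l El.
  destruct l as [|y l]; [discriminate|]; inversion El as [El'].
  destruct (HB R x) as [R' [ER' HR']], (HD R') as [r' [Er' Hr']].
  unfold apps; cbn [fold_left]; rewrite Hr; cbn [den scons]; rewrite ER', Er'.
  specialize (Hr' y l El'); unfold apps in Hr'; cbn [fold_left] in Hr'.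
  rewrite Hr', HR'; now ev.
Qed.

Lemma cnum_computable (e : prog) (n : nat) : exists r : X,
  forall (v : list nat) (m : nat),
    length v = n -> computes e v m -> apps r (map cnum v) = cnum m.
Proof.
destruct (computable_list e) as [R HR], n as [|n].
- destruct (R • cargs []) as [r|] eqn:E.
  + exists r; intros [|x v] m El H; [|discriminate].
    rewrite <- (HR _ _ H); symmetry; exact E.
  + exists R; intros [|x v] m El H; [|discriminate].
    apply HR in H; rewrite E in H; discriminate.
- destruct (uncurry n) as [D HD], (HD R) as [r [_ Hr]].
  exists r; intros [|x v] m El H; [discriminate|].
  cbn [map]; rewrite Hr by (rewrite length_map; now inversion El).
  now apply (HR (x :: v) m).
Qed.

Lemma ctup_comp : exists r : X, forall u i (x : X),
  nth_error u i = Some x -> r • ctup u • cnum i = x.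
Proof.
destruct (fixpoint (If (P0 (P0 (V 0))) (P0 (P1 (V 0)))
  (Ap (V 1) (PR (P1 (P0 (V 0))) (P1 (P1 (V 0))))))) as [env [N HN]].
destruct (lam2 (Ap (Q N) (PR (V 0) (P1 (V 1))))) as [env' [r Hr]].
exists r; intros u i x E.
destruct (Hr (ctup u)) as [r' [-> Hr']]; rewrite Hr'; unfold ctup; ev.
clear r r' Hr Hr'; revert u E; induction i as [|i IH]; intros [|y u] E; try discriminate;
  rewrite HN.
- rewrite If_tru by now ev.
  ev; now inversion E.
- rewrite If_fls by now ev.
  ev; now apply IH.
Qed.

Lemma ctup_cat : exists r : X, forall u v, r • ctup u • ctup v = ctup (u ++ v).
Proof.
destruct (fixpoint (If (P0 (P0 (V 0))) (P1 (V 0))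
  (PR (Q (fls b)) (Ap (V 1) (PR (P1 (P0 (V 0))) (P1 (V 0)))))))
  as [env [add Hadd]].
assert (Hadd' : forall n m, add • pair (cnum n) (cnum m) = cnum (n + m)).
{ intros n m; induction n as [|n IH]; rewrite Hadd.
  - rewrite If_tru by now ev.
    now ev.
  - rewrite If_fls by now ev.
    ev; rewrite IH; ev; reflexivity. }
destruct (fixpoint (If (P0 (P0 (P0 (V 0)))) (P1 (V 0))
  (PR (P0 (P1 (P0 (V 0))))
      (Ap (V 1) (PR (PR (P1 (P0 (P0 (V 0)))) (P1 (P1 (P0 (V 0))))) (P1 (V 0)))))))
  as [env' [cat Hcat]].
assert (Hcat' : forall u v, cat • pair (ctup u) (clist v) = clist (u ++ v)).
{ intros u v; induction u as [|x u IH]; rewrite Hcat; unfold ctup.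
  - rewrite If_tru by now ev.
    now ev.
  - rewrite If_fls by now ev.
    ev; unfold ctup in IH; rewrite IH; now ev. }
destruct (lam2 (PR (Ap (Q add) (PR (P0 (V 1)) (P0 (V 0))))
                   (Ap (Q cat) (PR (V 1) (P1 (V 0)))))) as [env'' [r Hr]].
exists r; intros u v; destruct (Hr (ctup u)) as [r' [-> Hr']]; rewrite Hr'.
unfold ctup in Hcat' |- *; ev; rewrite Hadd', Hcat'; ev.
now rewrite length_app.
Qed.

Lemma coding_from_pairing : inhabited (coding X).
Proof.
destruct ctup_comp as [cmp Hcmp], ctup_cat as [cat Hcat].
destruct (lam1 (PR (Q (cnum 1)) (PR (V 0) (Q (tru b))))) as [e1 [sg Hsg]].
assert (Hsg' : forall y : X, sg • y = ctup [y]).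
{ intros y; rewrite Hsg; unfold ctup; now ev. }
destruct (lam2 (Ap (Ap (Q cat) (V 1)) (Ap (Q sg) (V 0)))) as [e2 [sn Hsn]].
assert (Hsn' : forall u (y : X), sn • ctup u • y = ctup (u ++ [y])).
{ intros u y; destruct (Hsn (ctup u)) as [r [-> Hr]]; rewrite Hr.
  ev; now rewrite Hsg', Hcat. }
constructor.
exact (@Coding X b pr pr0 pr1 pair pr_pair pr0_pair pr1_pair cnum cnum_inj
  cnum_computable ctup ctup_inj pr0 (fun u => pr0_pair _ _) cmp Hcmp cat Hcat
  sg Hsg' sn Hsn').
Qed.

End Codings.

End CodingExists.

Lemma coding_exists (X : pca) : inhabited (coding X).
Proof.
destruct (CodingExists.booleans_pairing X) as [b [pr [pair [H1 H2]]]].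
destruct (CodingExists.projections H2) as [pr0 [pr1 [H3 H4]]].
destruct (CodingExists.conditional b pr) as [If [H5 H6]].
exact (CodingExists.coding_from_pairing H1 H3 H4 H5 H6).
Qed.

(* Main.v *)
Require Import Defs.
From Stdlib Require Import List ClassicalEpsilon FunctionalExtensionality.
Import ListNotations.
Set Implicit Arguments.
Unset Strict Implicit.

(** Call the elements of [delta a] the names of [a].

    The greatest morphism [epsilon] sends a function [f : A -> A] to the set of
    all its representers: the elements of [B] that send names of [a] to
    names of [f a].  This set is nonempty exactly because every total function is representable.

    It is applicative because an interrogation of [beta] by [alpha] can be
    simulated in [B]: a name of a tuple code is passed to a representer of
    [alpha]; the marker of the resulting name is decided with the realizer of
    the decidability of [delta]; a query is passed to a representer of [beta]
    and its answer appended to the tuple ([simulation]).  It is decidable because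
    two distinct functions differ at some argument, and a total function on [A]
    maps the two values to the two Booleans ([represents_decidable]).  A
    representer of a constant function amounts to a name of its value
    ([represents_const]), so restricting [epsilon] to constants gives [delta].

    It is greatest because [K2] contains an element [e] with
    [e alpha (hat a) = hat (alpha a)], where [hat] makes constant functions
    ([K2_eval_const]).  If [epsilon'] also extends [delta], then realizing this
    equation along [epsilon'] turns an element of [epsilon' alpha] into one that
    takes names of [a] to names of [alpha a]
    ([represents_greatest]). *)

Ltac eval_exp := cbn [CodingExists.den CodingExists.scons].

Definition represents (A B : pca) (delta : A -> B -> Prop) (f : A -> A) (r : B) :
  Prop :=
  forall (a : A) (y : B), delta a y -> exists z : B, r • y = z /\ delta (f a) z.

Definition realizes (X Y : pca) (g : X -> Y -> Prop) (t : Y) : Prop :=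
  forall (x x' xx' : X) (y y' : Y),
    g x y -> g x' y' -> x • x' = xx' -> exists z : Y, t • y • y' = z /\ g xx' z.

Lemma realizes2 (X Y : pca) (g : X -> Y -> Prop) (t : Y) :
  realizes g t ->
  forall (x x1 x2 w : X) (y y1 y2 : Y),
    g x y -> g x1 y1 -> g x2 y2 -> x • x1 • x2 = w ->
    exists z : Y, t • (t • y • y1) • y2 = z /\ g w z.
Proof.
intros Ht x x1 x2 w y y1 y2 H H1 H2 E.
destruct (x • x1) as [v|] eqn:Ev; [|discriminate].
destruct (Ht _ _ _ _ _ H H1 Ev) as [u [-> Hu]].
exact (Ht _ _ _ _ _ Hu H2 E).
Qed.

Lemma infinite_nontrivial (A : Type) : ~ Finite A -> exists a b : A, a <> b.
Proof.
intros inf; apply NNPP; intros triv; apply inf.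
destruct (classic (inhabited A)) as [[a]|empty].
- exists [a]; intros b; left; apply NNPP; intros ne; apply triv; eauto.
- exists []; intros b; destruct empty; now constructor.
Qed.

(** The loop receives representers [r] of [alpha] and [q] of [beta] and a name
    [y] of the code of the interrogation so far.  It takes them one at a time,
    so that the fixed point of one variable suffices without pairing in [B]. *)
Lemma interrogation_loop (B : pca) (bB : booleans B) (d t p0 p1 sn : B) :
  exists h : B, (forall r q : B, exists u : B, h • r • q = u) /\
  forall (r q y v : B), r • y = v ->
    (d • (t • p0 • v) = tru bB -> h • r • q • y = t • p1 • v) /\
    (d • (t • p0 • v) = fls bB ->
     h • r • q • y = h • r • q • (t • (t • sn • y) • (q • (t • p1 • v)))).
Proof.
(* [d] serves as the dummy argument that forces the chosen branch. *)
destruct (CodingExists.conditional bB d) as [If [If_tru If_fls]].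
destruct (CodingExists.abstraction B) as [abs Habs].
pose (value := CodingExists.Ap (CodingExists.V B 2) (CodingExists.V B 0)).
pose (call f x y := CodingExists.Ap (CodingExists.Ap f x) y : CodingExists.exp B).
pose (rest := call (CodingExists.Q t) (CodingExists.Q p1) value).
(* In [body], the indices 0, 1, 2, 3 stand for [y], [q], [r], [h]. *)
pose (body := If
  (CodingExists.Ap (CodingExists.Q d)
     (call (CodingExists.Q t) (CodingExists.Q p0) value))
  rest
  (CodingExists.Ap (call (CodingExists.V B 3) (CodingExists.V B 2)
                         (CodingExists.V B 1))
     (call (CodingExists.Q t)
        (call (CodingExists.Q t) (CodingExists.Q sn) (CodingExists.V B 0))
        (CodingExists.Ap (CodingExists.V B 1) rest)))).
destruct (CodingExists.fixpoint (abs (abs body))) as [env [h Hh]].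
assert (H : forall r q : B, exists u : B, h • r • q = u /\ forall y : B,
  u • y = CodingExists.den (CodingExists.scons y (CodingExists.scons q
            (CodingExists.scons r (CodingExists.scons h env)))) body).
{ intros r q; rewrite Hh.
  destruct (Habs (CodingExists.scons r (CodingExists.scons h env)) (abs body))
    as [u1 [-> H1]].
  rewrite H1; apply Habs. }
exists h; split.
- intros r q; destruct (H r q) as [u [E _]]; now exists u.
- intros r q y v Ev; destruct (H r q) as [u [Eu Hu]].
  rewrite !Eu, Hu; unfold body, rest, value, call; split; intros E.
  + rewrite If_tru.
    * eval_exp; now rewrite Ev.
    * eval_exp; now rewrite Ev.
  + rewrite If_fls.
    * eval_exp; now rewrite Ev, Eu.
    * eval_exp; now rewrite Ev.
Qed.

(** The marker of the current name decides which branch of the loop is taken, so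
    each step of the interrogation is matched by one round of the loop. *)
Lemma simulation (A : pca) (c : coding A) (B : pca) (bB : booleans B)
    (delta : A -> B -> Prop) :
  is_applicative delta -> decidable_morph c bB delta ->
  exists h : B, (forall r q : B, exists u : B, h • r • q = u) /\
  forall (alpha beta : A -> A) (r q : B),
    represents delta alpha r -> represents delta beta q ->
    forall (l : list A) (w : A), run c alpha beta l w ->
    forall y : B, delta (tup c l) y ->
    exists z : B, h • r • q • y = z /\ delta w z.
Proof.
intros [total [t Ht]] [d [d_tru d_fls]].
destruct (total (pr0 c)) as [p0 Hp0], (total (pr1 c)) as [p1 Hp1].
destruct (total (tup_snoc c)) as [sn Hsn].
destruct (interrogation_loop bB d t p0 p1 sn) as [h [Hdef Hh]].
exists h; split; [exact Hdef|].
intros alpha beta r q Hr Hq l w Hrun.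
induction Hrun as [l w E|l b w E _ IH]; intros y Hy;
  destruct (Hr _ _ Hy) as [v [Ev Hv]]; rewrite E in Hv;
  destruct (Hh r q y v Ev) as [Htru Hfls];
  destruct (Ht _ _ _ _ _ Hp0 Hv (pr0_pair _ _ _)) as [m [Em Hm]];
  destruct (Ht _ _ _ _ _ Hp1 Hv (pr1_pair _ _ _)) as [x [Ex Hx]].
- rewrite Htru by (rewrite Em; now apply d_tru).
  now exists x.
- rewrite Hfls by (rewrite Em; now apply d_fls).
  rewrite Ex; destruct (Hq _ _ Hx) as [x' [-> Hx']].
  destruct (realizes2 Ht Hsn Hy Hx' (tup_snocE _ _ _)) as [y' [-> Hy']].
  now apply IH.
Qed.

Lemma represents_applicative (A : pca) (c : coding A) (B : pca)
    (bB : booleans B) (delta : A -> B -> Prop) :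
  is_applicative delta -> decidable_morph c bB delta ->
  (forall f : A -> A, representable delta (fun a => Some (f a))) ->
  is_applicative (X := K2 c) (represents delta).
Proof.
intros app dec rep; split.
{ intros f; destruct (rep f) as [r Hr]; exists r; intros a y Hy.
  now apply (Hr a). }
destruct (simulation app dec) as [h [_ Hh]].
destruct app as [total [t Ht]].
destruct (total (tup_sing c)) as [sg Hsg].
destruct (CodingExists.lam3 (CodingExists.Ap
  (CodingExists.Ap (CodingExists.Ap (CodingExists.Q h) (CodingExists.V B 2))
     (CodingExists.V B 1))
  (CodingExists.Ap (CodingExists.Ap (CodingExists.Q t) (CodingExists.Q sg))
     (CodingExists.V B 0)))) as [env [s Hs]].
exists s; intros alpha beta f r q Hr Hq E.
destruct (Hs r q) as [u [Eu Hu]]; exists u; split; [exact Eu|].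
intros a y Hy; rewrite Hu; eval_exp.
destruct (Ht _ _ _ _ _ Hsg Hy (tup_singE _ _)) as [y' [-> Hy']].
refine (Hh alpha beta r q Hr Hq [a] (f a) _ y' Hy').
now apply K2_app_run.
Qed.

Lemma represents_decidable (A : pca) (c : coding A) (B : pca)
    (bB : booleans B) (bK : booleans (K2 c)) (delta : A -> B -> Prop) :
  (exists a b : A, a <> b) ->
  is_applicative delta -> decidable_morph c bB delta ->
  (forall f : A -> A, representable delta (fun a => Some (f a))) ->
  decidable_morph bK bB (represents delta).
Proof.
intros nt [total _] [d [d_tru d_fls]] rep.
assert (differ : exists a, tru bK a <> fls bK a).
{ apply NNPP; intros N; apply (tru_neq_fls (b := bK)).
  - destruct nt as [a [b ne]]; exists (fun _ => a), (fun _ => b); intros E.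
    apply ne; exact (f_equal (fun f : A -> A => f a) E).
  - apply functional_extensionality; intros a.
    apply NNPP; intros ne; apply N; now exists a. }
destruct differ as [a ne], (total a) as [y Hy].
pose (f x := if excluded_middle_informative (x = tru bK a)
             then tru c else fls c).
destruct (rep f) as [q Hq].
destruct (CodingExists.lam1 (CodingExists.Ap (CodingExists.Q d)
  (CodingExists.Ap (CodingExists.Q q)
     (CodingExists.Ap (CodingExists.V B 0) (CodingExists.Q y)))))
  as [env [e He]].
exists e; split; intros r Hr; rewrite He; eval_exp;
  destruct (Hr _ _ Hy) as [v [-> Hv]];
  destruct (Hq _ _ _ eq_refl Hv) as [x [-> Hx]]; unfold f in Hx;
  destruct (excluded_middle_informative _) as [E|N].
- now apply d_tru.
- now destruct N.
- symmetry in E; now destruct ne.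
- now apply d_fls.
Qed.

(** A representer of the constant [a] yields a name of [a] when applied to any
    fixed name; conversely a name [y] of [a] yields the representer [k y]. *)
Lemma represents_const (A : pca) (c : coding A) (B : pca)
    (delta : A -> B -> Prop) :
  (forall a, exists y, delta a y) ->
  iso_morph (comp_morph (Y := K2 c) (represents delta) (const_morph c)) delta.
Proof.
intros total; split.
- destruct (pca_point A) as [a0 _], (total a0) as [y0 Hy0].
  destruct (CodingExists.lam1 (CodingExists.Ap (CodingExists.V B 0)
    (CodingExists.Q y0))) as [env [e He]].
  exists e; intros a r [f [-> Hr]]; rewrite He; exact (Hr _ _ Hy0).
- destruct (CodingExists.lam2 (CodingExists.V B 1)) as [env [k Hk]].
  exists k; intros a y Hy; destruct (Hk y) as [r [Er Hr]].
  exists r; split; [exact Er|].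
  exists (fun _ => a); split; [reflexivity|].
  intros a' y' _; exists y; split; [apply Hr|exact Hy].
Qed.

(** The witness queries its second argument at the input and its first argument
    at the answer, that is, it composes the two functions. *)
Lemma K2_eval_const (A : pca) (c : coding A) :
  (exists a b : A, a <> b) ->
  exists e : K2 c, forall (alpha : K2 c) (a : A),
    e • alpha • val (X := K2 c) (fun _ => a) = val (X := K2 c) (fun _ => alpha a).
Proof.
intros nt.
destruct (curry2 c (fun x => AskR x (fun u => AskL u Ret2)) nt) as [e He].
exists e; intros alpha a; destruct (He alpha) as [f [Ef Hf]].
unfold oapp, val; simpl; rewrite Ef; exact (Hf (fun _ => a)).
Qed.

Lemma represents_greatest (A : pca) (c : coding A) (B : pca)
    (delta : A -> B -> Prop) (epsilon : K2 c -> B -> Prop) :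
  (exists a b : A, a <> b) ->
  is_applicative epsilon ->
  iso_morph (comp_morph epsilon (const_morph c)) delta ->
  preceq epsilon (represents delta).
Proof.
intros nt [total [t Ht]] [[o Ho] [i Hi]].
destruct (K2_eval_const c nt) as [e He], (total e) as [y_e Hy_e].
destruct (CodingExists.lam2 (CodingExists.Ap (CodingExists.Q o)
  (CodingExists.Ap
    (CodingExists.Ap (CodingExists.Q t)
       (CodingExists.Ap (CodingExists.Ap (CodingExists.Q t) (CodingExists.Q y_e))
          (CodingExists.V B 1)))
    (CodingExists.Ap (CodingExists.Q i) (CodingExists.V B 0)))))
  as [env [s Hs]].
exists s; intros alpha r Hr; destruct (Hs r) as [u [Eu Hu]].
exists u; split; [exact Eu|]; intros a y Hy; rewrite Hu; eval_exp.
destruct (Hi _ _ Hy) as [x [-> [f [-> Hx]]]].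
destruct (realizes2 Ht Hy_e Hr Hx (He alpha a)) as [z [-> Hz]].
apply Ho; now exists (fun _ => alpha a).
Qed.

Unset Implicit Arguments.

Theorem theorem3p3 (A : pca) (c : coding A) (A_infinite : ~ Finite A)
    (B : pca) (bB : booleans B) (bK : booleans (K2 c))
    (delta : A -> B -> Prop) :
  is_applicative delta ->
  decidable_morph c bB delta ->
  (forall f : A -> A, representable delta (fun a => Some (f a))) ->
  exists epsilon : K2 c -> B -> Prop,
    is_applicative epsilon /\
    decidable_morph bK bB epsilon /\
    iso_morph (comp_morph epsilon (const_morph c)) delta /\
    forall epsilon' : K2 c -> B -> Prop,
      is_applicative epsilon' ->
      decidable_morph bK bB epsilon' ->
      iso_morph (comp_morph epsilon' (const_morph c)) delta ->
      preceq epsilon' epsilon.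
Proof.
intros app dec rep.
assert (nt := infinite_nontrivial A_infinite).
exists (represents delta); repeat split.
- now apply (represents_applicative app dec rep).
- now apply (represents_applicative app dec rep).
- now apply represents_decidable.
- apply represents_const, app.
- apply represents_const, app.
- intros epsilon' app' _ iso'; now apply represents_greatest.
Qed.
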